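(* Let $P\subseteq M_{\mathbb R}$ be a $d$-dimensional centrally symmetric canonical Fano polytope. Then $$|P\cap M|\le 3^d.$$ Any facet of $P$ has at most $3^{d-1}$ lattice points. If $P$ is additionally reflexive, then the following statements are equivalent: 1. $|P\cap M|=3^d$. 2. Every facet of $P$ has $3^{d-1}$ lattice points. 3. $P\cong[-1,1]^d$ as lattice polytopes (where $[-1,1]^d$ is taken with respect to $\mathbb Z^d$).
   Context: Let $M\cong\mathbb Z^d$ be a lattice with dual lattice $N$, $M_{\mathbb R}=M\otimes\mathbb R$. A canonical Fano polytope is a $d$-dimensional lattice polytope $P\subseteq M_{\mathbb R}$ (vertices in $M$) with $\mathrm{int}\,P\cap M=\{0\}$. It is reflexive if its dual $P^*=\{y\in N_{\mathbb R}:\langle x,y\rangle\ge -1\ \forall x\in P\}$ is a lattice polytope. $P$ is centrally symmetric if $P=-P$. An isomorphism of lattice polytopes is an isomorphism of the lattices whose real linear extension maps one polytope onto the other. *)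

(* Defs.v *)
From HB Require Import structures.
From mathcomp Require Import all_boot all_order all_algebra.
From mathcomp Require Import all_classical all_reals all_analysis.

Set Implicit Arguments.
Unset Strict Implicit.
Unset Printing Implicit Defensive.

Import Order.TTheory GRing.Theory Num.Theory.
Import numFieldNormedType.Exports.

Local Open Scope classical_set_scope.
Local Open Scope ring_scope.

(* A basis of the lattice M is fixed: M = Z^d is 'rV[int]_d, M_R = R^d is
   'rV[R]_d, and the dual lattice N and N_R are written in the dual basis, so
   they are again 'rV[int]_d and 'rV[R]_d, with <x, y> = \sum_i x_i y_i. *)

Section LatticePolytopes.
Variables (R : realType) (d : nat).
Implicit Types (P Q F A S : set 'rV[R]_d).

Definition lattice_emb : 'rV[int]_d -> 'rV[R]_d := map_mx intr.

Definition lattice : set 'rV[R]_d := range lattice_emb.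

Definition pairing (x y : 'rV[R]_d) : R := \sum_(i < d) x 0 i * y 0 i.

Definition convex_hull S : set 'rV[R]_d :=
  smallest (fun A : set 'rV[R]_d => convex_set A) S.

Definition polytope P := exists2 S, finite_set S & P = convex_hull S.

Definition affine_set A :=
  forall (x y : 'rV[R]_d) (t : R), A x -> A y -> A (t *: x + (1 - t) *: y).

Definition affine_hull S : set 'rV[R]_d := smallest affine_set S.

(* The affine hull of A is a translate of a k-dimensional linear subspace;
   in particular A is nonempty. *)
Definition has_dim A (k : nat) :=
  exists (x0 : 'rV[R]_d) (U : {vspace 'rV[R]_d}),
    \dim U = k /\ affine_hull A = [set x : 'rV[R]_d | x - x0 \in U].

(* u = 0 is allowed, so the empty set and P itself count as faces of P. *)
Definition face P F :=
  exists (u : 'rV[R]_d) (b : R),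
    (forall x, P x -> b <= pairing x u) /\
    F = P `&` [set x | pairing x u = b].

Definition vertex P (v : 'rV[R]_d) := face P [set v].

Definition facet P F :=
  face P F /\ exists k : nat, has_dim P k.+1 /\ has_dim F k.

Definition lattice_polytope P :=
  polytope P /\ forall v, vertex P v -> lattice v.

Definition canonical_fano P :=
  [/\ lattice_polytope P, has_dim P d & P° `&` lattice = [set 0]].

Definition dual_polytope P : set 'rV[R]_d :=
  [set y | forall x, P x -> - 1 <= pairing x y].

Definition reflexive_polytope P := lattice_polytope (dual_polytope P).

Definition centrally_symmetric P := P = [set - x | x in P].

Definition cube : set 'rV[R]_d :=
  [set x : 'rV[R]_d | forall i, - 1 <= x 0 i <= 1].

Definition lattice_isomorphic P Q :=
  exists (f : {additive 'rV[int]_d -> 'rV[int]_d})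
         (g : {linear 'rV[R]_d -> 'rV[R]_d}),
    [/\ bijective f,
        forall m, g (lattice_emb m) = lattice_emb (f m) &
        g @` P = Q].

End LatticePolytopes.

Arguments lattice {R d}.
Arguments cube {R d}.

(* Main.v *)
Require Import Defs.
From HB Require Import structures.
From mathcomp Require Import all_boot all_order all_algebra.
From mathcomp Require Import all_classical all_reals all_analysis.
From mathcomp Require Import ring lra zify.

Set Implicit Arguments.
Unset Strict Implicit.
Unset Printing Implicit Defensive.

Import Order.TTheory GRing.Theory Num.Theory.
Import numFieldNormedType.Exports.

Local Open Scope classical_set_scope.
Local Open Scope card_scope.
Local Open Scope ring_scope.

(** Reduce lattice points modulo 3.  If [v] and [w] are lattice points of [P]
    with the same residue, then [(v - w) / 3] is a lattice point and equals
    two thirds of the midpoint of [v] and [- w], so it is interior to [P] and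
    therefore zero ([third_difference_interior], [red_inj]).  Counting lattice
    points of a subset of [P] is thus counting residues in [F_3^d]
    ([card_residues]), which gives the bound [3^d].

    The lattice points of a facet differ by integer vectors orthogonal to its
    normal.  Integer vectors annihilated by a nonzero real functional are, after
    reduction, annihilated by a nonzero functional over [F_3]: otherwise [d] of
    them would form a matrix with determinant prime to 3, hence invertible over
    the reals ([annihilated_mod3]).  So the residues of a facet lie in one
    affine hyperplane of [F_3^d] ([card_residues_facet]).

    Let [P] be reflexive.  A facet spans a hyperplane missing the origin, which
    makes its normal, scaled so that the facet is [<x, u> = -1], a vertex of the
    dual polytope; hence [u] is a lattice vector ([facet_normal_vertex]) and by
    symmetry takes only the values -1, 0, 1 on the lattice points of [P].  If
    all residues are attained by [P], those with [<c, u> = -1] are attained on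
    the facet, and there are [3^(d-1)] of them ([card_residues_facet_full]).

    Conversely suppose that every facet has [3^(d-1)] lattice points, so that
    each facet attains every residue of its hyperplane.  If three lattice points
    of a facet have sum zero modulo 3, their barycenter is again a lattice point
    of the facet.  Playing this against the values of a second normal shows that
    a normal which depends modulo 3 on independent normals is plus or minus one
    of them ([full_normal_support], [full_normal_red_inj]).  Every nonzero
    vector pairs nontrivially with some facet normal ([facet_normal_neg]), so
    one can pick [d] normals independent modulo 3.  In the coordinates they
    define, [P] lies in the cube, and all nonzero vectors with entries -1, 0, 1
    are lattice points of [P] ([full_normals_realize]).  The unit vectors among
    them show that the coordinate change is unimodular, and the corners that [P]
    is the whole cube ([full_normals_cube]).  Finally the cube has [3^d] lattice
    points, and a lattice isomorphism preserves their number
    ([isomorphic_cube_residues]). *)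

(** * Dot product and greedy bases *)

Section Dot.
Context {K : comNzRingType} {n : nat}.
Implicit Types x y z : 'rV[K]_n.

Definition dot x y : K := \sum_(i < n) x 0 i * y 0 i.

Lemma dotC x y : dot x y = dot y x.
Proof. by apply: eq_bigr => i _; rewrite mulrC. Qed.

Lemma dotDl x y z : dot (x + y) z = dot x z + dot y z.
Proof. by rewrite -big_split; apply: eq_bigr => i _; rewrite mxE mulrDl. Qed.

Lemma dotZl a x y : dot (a *: x) y = a * dot x y.
Proof. by rewrite mulr_sumr; apply: eq_bigr => i _; rewrite mxE mulrA. Qed.

Lemma dotNl x y : dot (- x) y = - dot x y.
Proof. by rewrite -scaleN1r dotZl mulN1r. Qed.

Lemma dotBl x y z : dot (x - y) z = dot x z - dot y z.
Proof. by rewrite dotDl dotNl. Qed.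

Lemma dot0l x : dot 0 x = 0.
Proof. by rewrite -(scale0r 0) dotZl mul0r. Qed.

Lemma dotDr x y z : dot z (x + y) = dot z x + dot z y.
Proof. by rewrite ![dot z _]dotC dotDl. Qed.

Lemma dotZr a x y : dot y (a *: x) = a * dot y x.
Proof. by rewrite ![dot y _]dotC dotZl. Qed.

Lemma dotNr x y : dot y (- x) = - dot y x.
Proof. by rewrite ![dot y _]dotC dotNl. Qed.

Lemma dotBr x y z : dot z (x - y) = dot z x - dot z y.
Proof. by rewrite dotDr dotNr. Qed.

Lemma dot0r x : dot x 0 = 0.
Proof. by rewrite dotC dot0l. Qed.

Lemma dot_suml I (r : seq I) (F : I -> 'rV[K]_n) y :
  dot (\sum_(i <- r) F i) y = \sum_(i <- r) dot (F i) y.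
Proof.
by apply: (big_morph (dot^~ y)) => [u v|]; [exact: dotDl | exact: dot0l].
Qed.

Lemma mulmx_tr_dot m (X : 'M[K]_(m, n)) y i : (X *m y^T) i 0 = dot (row i X) y.
Proof. by rewrite mxE; apply: eq_bigr => j _; rewrite !mxE. Qed.

Lemma mulmx_trE m x (X : 'M[K]_(m, n)) i : (x *m X^T) 0 i = dot x (row i X).
Proof. by rewrite mxE; apply: eq_bigr => j _; rewrite !mxE. Qed.

Lemma dot_mulmxl m (a : 'rV[K]_m) (X : 'M[K]_(m, n)) y :
  dot (a *m X) y = \sum_i a 0 i * dot (row i X) y.
Proof. by rewrite mulmx_sum_row dot_suml; apply: eq_bigr => i _; rewrite dotZl. Qed.

Lemma mulmx_tr_eq0 m (X : 'M[K]_(m, n)) y :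
  (forall i, dot (row i X) y = 0) -> X *m y^T = 0.
Proof. by move=> h; apply/matrixP => i j; rewrite ord1 mulmx_tr_dot h mxE. Qed.

Lemma dot_delta i x : dot (delta_mx 0 i) x = x 0 i.
Proof.
rewrite /dot (bigD1 i) //= big1 ?addr0 ?mxE ?eqxx ?mul1r // => j ji.
by rewrite !mxE (negPf ji) mul0r.
Qed.

End Dot.

Lemma dot_map {K L : comNzRingType} (f : {rmorphism K -> L}) n (x y : 'rV[K]_n) :
  dot (map_mx f x) (map_mx f y) = f (dot x y).
Proof. by rewrite rmorph_sum; apply: eq_bigr => i _; rewrite !mxE rmorphM. Qed.

Lemma unitmx_dot_inj (K : comUnitRingType) n (X : 'M[K]_n) (y z : 'rV[K]_n) :
  X \in unitmx -> (forall i, dot (row i X) y = dot (row i X) z) -> y = z.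
Proof.
move=> uX h; apply/eqP; rewrite -subr_eq0 -trmx_eq0; apply/eqP.
apply: (can_inj (mulKmx uX)); rewrite mulmx0; apply: mulmx_tr_eq0 => i.
by rewrite dotBr h subrr.
Qed.

Section Greedy.
Context {K : fieldType} {d : nat}.
Implicit Types x y : 'rV[K]_d.

Lemma common_orthogonal k (X : 'M[K]_(k, d)) : (k < d)%N ->
  exists2 y, y != 0 & forall i, dot (row i X) y = 0.
Proof.
move=> kd; have : kermx X^T != 0.
  rewrite kermx_eq0 /row_free mxrank_tr neq_ltn.
  by rewrite (leq_ltn_trans (rank_leq_row X) kd).
case/rowV0Pn => y /sub_kermxP yX y0; exists y => // i.
by rewrite -mulmx_tr_dot -[X]trmxK -trmx_mul yX !mxE.
Qed.

Lemma row_free_col_mx k (X : 'M[K]_(k, d)) x :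
  row_free X -> ~~ (x <= X)%MS -> row_free (col_mx X x).
Proof.
move=> fX xX; rewrite /row_free eqn_leq rank_leq_row /=.
rewrite -addsmxE addn1; apply: leq_ltn_trans (_ : k <= \rank X)%N _.
  by rewrite (eqP fX).
apply: rank_ltmx.
by rewrite ltmxE addsmxSl addsmx_sub submx_refl.
Qed.

Lemma row_free_col_mx_dot k (X : 'M[K]_(k, d)) x y :
  row_free X -> (forall i, dot (row i X) y = 0) -> dot x y != 0 ->
  row_free (col_mx X x).
Proof.
move=> fX Xy xy; apply: row_free_col_mx => //; apply: contraNN xy.
case/submxP => a ->; rewrite dot_mulmxl big1 // => i _.
by rewrite Xy mulr0.
Qed.

Lemma col_mx_rows k (X : 'M[K]_(k, d)) x (A : set 'rV[K]_d) :
  (forall i, A (row i X)) -> A x -> forall i, A (row i (col_mx X x)).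
Proof.
move=> AX Ax i; case: (split_ordP i) => j ->; first by rewrite rowKu.
by rewrite rowKd row_id.
Qed.

(** A basis is extracted greedily: as long as fewer than [d] rows are chosen,
    some nonzero vector is orthogonal to all of them, and an element of [A] not
    orthogonal to it can be added. *)
Lemma spanning_unitmx (A : set 'rV[K]_d) :
  (forall y, (forall x, A x -> dot x y = 0) -> y = 0) ->
  exists2 X : 'M[K]_d, X \in unitmx & forall i, A (row i X).
Proof.
move=> spA.
suff /(_ d (leqnn d)) [X fX AX] : forall k, (k <= d)%N ->
    exists2 X : 'M[K]_(k, d), row_free X & forall i, A (row i X).
  by exists X; rewrite // -row_free_unit.
elim=> [|k IH] kd.
  by exists 0 => [|[]//]; rewrite /row_free mxrank0.
have [X fX AX] := IH (ltnW kd); have [y y0 Xy] := common_orthogonal X kd.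
have [x Ax xy] : exists2 x, A x & dot x y != 0.
  apply: contrapT => h; move/eqP: y0; apply; apply: spA => x Ax.
  by apply/eqP/negPn/negP => xy; apply: h; exists x.
rewrite -addn1; exists (col_mx X x); first exact: row_free_col_mx_dot Xy xy.
exact: col_mx_rows.
Qed.

End Greedy.

(** * Reduction modulo 3 *)

Notation red := (map_mx (intr : int -> 'F_3)).

Lemma intF3_eq0 (z : int) : (z%:~R == 0 :> 'F_3) = (3 %| z)%Z.
Proof. by rewrite -(dvdz_pcharf (pchar_Fp (erefl : prime 3))). Qed.

Lemma intF3_inj (y z : int) :
  -1 <= y <= 1 -> -1 <= z <= 1 -> y%:~R = z%:~R :> 'F_3 -> y = z.
Proof.
move=> hy hz /eqP; rewrite -subr_eq0 -rmorphB intF3_eq0 => /dvdzP[q].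
by lia.
Qed.

Lemma F3_cases (a : 'F_3) : [\/ a = 0, a = 1 | a = -1].
Proof.
case: a => [[|[|[|//]]] h]; [apply: Or31 | apply: Or32 | apply: Or33];
  exact: val_inj.
Qed.

Lemma red_dot d (m u : 'rV[int]_d) : (dot m u)%:~R = dot (red m) (red u) :> 'F_3.
Proof. by rewrite -dot_map. Qed.

Lemma red_eqP d (v w : 'rV[int]_d) :
  red v = red w -> exists m, v = w + m *+ 3.
Proof.
move=> /rowP vw.
exists (\row_i divz (v 0 i - w 0 i) 3); apply/rowP => i.
have : (3 %| (v 0%R i - w 0%R i)%R)%Z.
  by have /eqP := vw i; rewrite !mxE -intF3_eq0 rmorphB subr_eq0.
case/dvdzP=> q e; rewrite mxE mulmxnE mxE e mulzK //.
by rewrite -mulr_natr -[(_ * 3%:R)%R]e addrC subrK.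
Qed.

Lemma det_red_neq0 (R : numDomainType) d (M : 'M[int]_d) :
  red M \in unitmx -> \det (map_mx (intr : int -> R) M) != 0.
Proof.
rewrite unitmxE !det_map_mx unitfE intF3_eq0 intr_eq0.
by apply: contraNneq => ->.
Qed.

(** Contrapositive: if no nonzero functional over [F_3] kills the residues,
    they contain a basis of [F_3^d].  The corresponding integer vectors form a
    matrix with determinant nonzero modulo 3, so they span the real space and
    only [t = 0] is orthogonal to them. *)
Lemma annihilated_mod3 (R : realType) d (A : set 'rV[int]_d) (t : 'rV[R]_d) :
  t != 0 -> (forall m, A m -> dot (lattice_emb R m) t = 0) ->
  exists2 u : 'rV['F_3]_d, u != 0 & forall m, A m -> dot (red m) u = 0.
Proof.
move=> t0 At; apply: contrapT => noU.
have spA u : (forall c, (red @` A) c -> dot c u = 0) -> u = 0.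
  move=> uA; apply/eqP/negPn/negP => u0; apply: noU; exists u => // m Am.
  by apply: uA; exists m.
have [X uX AX] := spanning_unitmx spA.
have /choice[m mP] i : exists m, A m /\ red m = row i X.
  by have [m] := AX i; exists m.
pose M : 'M[int]_d := \matrix_i m i.
have rM : red M = X.
  by apply/row_matrixP => i; rewrite -map_row rowK; case: (mP i).
have uM : map_mx (intr : int -> R) M \in unitmx.
  by rewrite unitmxE unitfE; apply: det_red_neq0; rewrite rM.
move/eqP: t0; apply; apply: (unitmx_dot_inj uM) => i.
by rewrite dot0r -map_row rowK; apply: At; case: (mP i).
Qed.

Section Count.
Context {d : nat}.
Implicit Types (c u : 'rV['F_3]_d).

Lemma dot_surj u (a : 'F_3) : u != 0 -> exists c, dot c u = a.
Proof.
case/rV0Pn => i ui; exists ((a / u 0 i) *: delta_mx 0 i).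
by rewrite dotZl dot_delta divfK.
Qed.

(** The three level sets of a nonzero functional are translates of each other
    and partition [F_3^d]. *)
Lemma card_hyperplane u (a : 'F_3) : u != 0 ->
  #|[set c | dot c u == a]%SET| = (3 ^ d.-1)%N.
Proof.
move=> u0; pose H b := [set c | dot c u == b]%SET.
have cardH b : #|H b| = #|H 0|.
  have [t tu] := dot_surj b u0.
  rewrite -(card_imset (H 0) (addIr t)); apply: eq_card => c.
  apply/idP/imsetP => [|[c']]; rewrite !inE => /eqP cu.
    by exists (c - t); rewrite ?subrK // inE dotBl cu tu subrr.
  by move=> ->; rewrite dotDl cu tu add0r.
have d0 : (0 < d)%N by case/rV0Pn: u0 => i _; apply: leq_ltn_trans (ltn_ord i).
have sumH : (\sum_(b : 'F_3) #|H b| = 3 ^ d)%N.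
  transitivity #|{: 'rV['F_3]_d}|; last by rewrite card_mx card_Fp // mul1n.
  rewrite -sum1_card (partition_big (fun c => dot c u) predT) //=.
  by apply: eq_bigr => b _; rewrite -sum1_card; apply: eq_bigl => c; rewrite inE.
have : (3 * #|H 0%R| = 3 * 3 ^ d.-1)%N.
  rewrite -expnS prednK // -sumH (eq_bigr (fun=> #|H 0%R|)).
    by rewrite sum_nat_const card_Fp.
  by move=> b _; exact: cardH.
by move/eqP; rewrite eqn_pmul2l // => /eqP <-; exact: cardH.
Qed.

End Count.

(** * Convexity and residues of lattice points *)

Section ConvexHull.
Context {R : realType} {d : nat}.
Implicit Types (P A S : set 'rV[R]_d) (x y u : 'rV[R]_d).

Lemma convex_setP A : convex_set A <->
  forall x y t, 0 <= t <= 1 -> A x -> A y -> A (t *: x + (1 - t) *: y).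
Proof.
split=> [cA x y t /andP[t0 t1] Ax Ay | cA x y t /set_mem Ax /set_mem Ay].
  by have /set_mem := cA x y (Itv01 t0 t1) (mem_set Ax) (mem_set Ay).
by apply/mem_set/cA => //; rewrite ge0 le1.
Qed.

Lemma convex_hull_convex S : convex_set (convex_hull S).
Proof.
apply/convex_setP => x y t t01 Sx Sy A SA; have /convex_setP cA := SA.1.
by apply: cA => //; [apply: Sx | apply: Sy].
Qed.

Lemma convex_hull_halfspace S u b :
  (forall x, S x -> b <= dot x u) -> forall x, convex_hull S x -> b <= dot x u.
Proof.
move=> Su; apply: (@smallest_sub _ _ _ [set x | b <= dot x u]) => //.
apply/convex_setP => x y t t01 /= bx byy; rewrite dotDl !dotZl; nra.
Qed.

Lemma polytope_convex P x y t : polytope P ->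
  0 <= t <= 1 -> P x -> P y -> P (t *: x + (1 - t) *: y).
Proof. by case=> S _ ->; have /convex_setP := @convex_hull_convex S; apply. Qed.

End ConvexHull.

Section LatticeEmbedding.
Context (R : realType) {d : nat}.
Notation emb := (@lattice_emb R d).

Lemma emb_inj : injective emb.
Proof.
move=> m n /rowP mn; apply/rowP => i.
by have := mn i; rewrite !mxE => /intr_inj.
Qed.

Lemma emb0 : emb 0 = 0.
Proof. exact: map_mx0. Qed.

Lemma embN m : emb (- m) = - emb m.
Proof. exact: map_mxN. Qed.

Lemma embD m n : emb (m + n) = emb m + emb n.
Proof. exact: map_mxD. Qed.

Lemma embB m n : emb (m - n) = emb m - emb n.
Proof. exact: map_mxB. Qed.

Lemma emb_mulrn m k : emb (m *+ k) = k%:R *: emb m.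
Proof. by rewrite scaler_nat; elim: k => [|k IH]; rewrite ?emb0 // !mulrS embD IH. Qed.

Lemma dot_emb m n : dot (emb m) (emb n) = (dot m n)%:~R.
Proof. exact: dot_map. Qed.

End LatticeEmbedding.

Section SymmetricCanonical.
Context {R : realType} {d : nat} {P : set 'rV[R]_d}.
Hypotheses (P_canonical : canonical_fano P) (P_symmetric : centrally_symmetric P).
Notation emb := (@lattice_emb R d).

Lemma canonical_polytope : polytope P.
Proof. by case: P_canonical => [[]]. Qed.

Lemma symmetric_opp x : P x -> P (- x).
Proof. by move=> Px; rewrite P_symmetric; exists x. Qed.

Lemma canonical_ball0 : exists2 e : R, 0 < e & forall x, `|x| < e -> P x.
Proof.
have [_ _ PL] := P_canonical.
have : (P° `&` lattice) 0 by rewrite PL.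
case=> /nbhs_ballP[e /= e0 eP] _; exists e => // x xe; apply: eP.
by rewrite -ball_normE /= sub0r normrN.
Qed.

Lemma canonical_mem0 : P 0.
Proof. by have [e e0] := canonical_ball0; apply; rewrite normr0. Qed.

(** The point [z] is two thirds of the midpoint of [x] and [- y], and the
    interior of a convex set with 0 in its interior contains [t x]
    for all its points [x] and [0 <= t < 1]. *)
Lemma third_difference_interior x y z : P x -> P y -> x - y = 3 *: z -> P° z.
Proof.
move=> Px Py xyz; have [e e0 eP] := canonical_ball0.
apply/nbhs_ballP; exists (e / 3) => /=; first by rewrite divr_gt0.
move=> w; rewrite -ball_normE /= => zw.
have Pv : P (3 *: (w - z)).
  apply: eP; rewrite normrZ distrC ger0_norm //; lra.
have Pm : P (2^-1 *: x + (1 - 2^-1) *: - y).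
  by apply: (polytope_convex canonical_polytope) => //; [lra | exact: symmetric_opp].
(* The error [w - z] of size below [e / 3] is absorbed by the weight 1/3 at 0. *)
suff -> : w = (2 / 3) *: (2^-1 *: x + (1 - 2^-1) *: - y)
              + (1 - 2 / 3) *: (3 *: (w - z)).
  by apply: (polytope_convex canonical_polytope) => //; lra.
move/rowP: xyz => xyz; apply/rowP => i; have := xyz i; rewrite !mxE; lra.
Qed.

(** If [v = w + 3 m], then [m] is an interior lattice point of [P], so [m = 0]. *)
Lemma red_inj v w : P (emb v) -> P (emb w) -> red v = red w -> v = w.
Proof.
move=> Pv Pw /red_eqP[m vwm].
have [_ _ PL] := P_canonical.
suff : (P° `&` lattice) (emb m).
  by rewrite PL /= vwm -(emb0 R) => /emb_inj ->; rewrite mul0rn addr0.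
split; last by exists m.
apply: third_difference_interior Pv Pw _.
by rewrite vwm embD addrC addKr emb_mulrn.
Qed.

End SymmetricCanonical.

Section Residues.
Context {R : realType} {d : nat}.
Implicit Types A P : set 'rV[R]_d.
Notation emb := (@lattice_emb R d).

Definition residues A : {set 'rV['F_3]_d} :=
  [set c | `[< exists m, A (emb m) /\ red m = c >]]%SET.

Lemma residuesP A c : reflect (exists m, A (emb m) /\ red m = c) (c \in residues A).
Proof. by rewrite inE; apply: asboolP. Qed.

Lemma mem_residues A m : A (emb m) -> red m \in residues A.
Proof. by move=> Am; apply/residuesP; exists m. Qed.

Lemma card_finset (T : finType) (X : {set T}) : [set` X] #= `I_#|X|.
Proof.
have -> : [set` X] = (enum_val : 'I_#|X| -> T) @` setT.
  apply/seteqP; split=> [x /= xX | _ [i _ <-] /=]; last exact: enum_valP.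
  by exists (enum_rank_in xX x) => //; rewrite enum_rankK_in.
apply: card_eq_trans (inj_card_eq _) _; first by apply: in2W; exact: enum_val_inj.
by rewrite card_eq_sym; exact: card_II.
Qed.

(** Residues replace possibly infinite sets by finite types: reduction is
    injective on the lattice points of [P]. *)
Lemma card_residues P A : canonical_fano P -> centrally_symmetric P ->
  A `<=` P -> A `&` lattice #= `I_#|residues A|.
Proof.
move=> cP sP AP.
pose B := [set m | A (emb m)].
have -> : A `&` lattice = emb @` B.
  apply/seteqP; split=> [_ [/[swap] -[m _ <-] Am] | _ [m Am <-]].
    by exists m.
  by split=> //; exists m.
apply: card_eq_trans (inj_card_eq (in2W (@emb_inj R d))) _.
have injB : {in B &, injective (red : 'rV_d -> _)}.
  by move=> v w /set_mem/AP Pv /set_mem/AP Pw; exact: (red_inj cP sP).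
apply: (@card_eq_trans _ _ _ _ (red @` B)).
  by rewrite card_eq_sym; exact: inj_card_eq.
suff -> : red @` B = [set` residues A] by exact: card_finset.
apply/seteqP; split=> [_ [m Am <-] | c /residuesP[m [Am <-]]]; last by exists m.
exact: mem_residues.
Qed.

End Residues.

(** * Facets and their normals *)

Section AffineHull.
Context {R : realType} {d : nat}.
Implicit Types (A F P : set 'rV[R]_d) (x y u : 'rV[R]_d).

Lemma affine_hull_affine A : affine_set (affine_hull A).
Proof. by move=> x y t Ax Ay B hB; exact: hB.1 (Ax B hB) (Ay B hB). Qed.

Lemma affine_hull_hyperplane A u b : (forall x, A x -> dot x u = b) ->
  forall x, affine_hull A x -> dot x u = b.
Proof.
move=> Au; apply: (@smallest_sub _ _ _ [set x | dot x u = b]) => //.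
move=> x y t /= xu yu; rewrite dotDl !dotZl xu yu; ring.
Qed.

Lemma full_dim_eq_fullv (U : {vspace 'rV[R]_d}) : \dim U = d -> U = fullv.
Proof.
move=> dU; apply/eqP; rewrite eqEdim subvf dimvf dU dim_matrix.
by rewrite [X in (X <= _)%N]mul1n leqnn.
Qed.

Lemma has_dim_full A k : has_dim A d -> has_dim A k -> k = d.
Proof.
case=> x [U [/full_dim_eq_fullv -> AU]] [y [V [<-]]].
rewrite AU => /seteqP[+ _]; rewrite /subset /= => UV.
suff -> : V = fullv by rewrite dimvf dim_matrix -[RHS](mul1n d).
apply/eqP; rewrite eqEsubv subvf /=; apply/subvP => v _.
by have := UV (v + y); rewrite memvf addrK; apply.
Qed.

End AffineHull.

Section Facets.
Context {R : realType} {d : nat} {P : set 'rV[R]_d}.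
Hypotheses (P_canonical : canonical_fano P) (P_symmetric : centrally_symmetric P).
Implicit Types (F : set 'rV[R]_d) (x y u : 'rV[R]_d).
Notation emb := (@lattice_emb R d).

(** Since 0 is interior, every facet normal can be scaled to the value -1 on its
    facet; the facet itself is then determined by the normal. *)
Definition facet_normal (Q : set 'rV[R]_d) u :=
  (forall x, Q x -> -1 <= dot x u) /\ facet Q (Q `&` [set x | dot x u = -1]).

Lemma canonical_has_dim : has_dim P d.
Proof. by case: P_canonical. Qed.

(** The bound [b] of a supporting functional is at most its value 0 at the
    origin.  If [b] were 0, symmetry would make the functional vanish on [P], and
    [P] would be its own facet, against the dimensions. *)
Lemma facet_has_normal F : facet P F ->
  exists2 u, facet_normal P u & F = P `&` [set x | dot x u = -1].
Proof.
move=> fF; have [[u [b [bP FE]]] [k [Pk Fk]]] := fF.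
have /= b0 : b <= dot 0 u by apply: bP; exact: (canonical_mem0 P_canonical).
have bneg : b < 0.
  rewrite lt_neqAle -{2}(dot0l u) b0 andbT; apply/eqP => bz.
  suff FP : F = P.
    have := has_dim_full canonical_has_dim Pk; rewrite FP in Fk.
    by rewrite (has_dim_full canonical_has_dim Fk); lia.
  rewrite FE; apply/seteqP; split=> [x []//|x Px]; split=> //=.
  have := bP _ Px; have := bP _ (symmetric_opp P_symmetric Px).
  by rewrite -![pairing _ _]/(dot _ _) dotNl bz; lra.
have Fu : F = P `&` [set x | dot x ((- b)^-1 *: u) = -1].
  have nb0 : - b != 0 by rewrite oppr_eq0 lt_eqF.
  rewrite FE; apply/seteqP; split=> x [Px xb]; split=> //=.
    by rewrite dotZr (xb : dot x u = b) -[b in _ * b]opprK mulrN mulVf.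
  move: xb => /= /(congr1 ( *%R (- b))).
  by rewrite dotZr mulrA divff // mul1r mulrN1 opprK.
exists ((- b)^-1 *: u) => //; split; last by rewrite -Fu.
move=> x /bP xb; rewrite dotZr mulrC ler_pdivlMr ?oppr_gt0 // mulN1r opprK.
exact: xb.
Qed.

Lemma facet_normal_dim u : facet_normal P u -> (0 < d)%N.
Proof. by case=> _ [_ [k [Pk _]]]; rewrite -(has_dim_full canonical_has_dim Pk). Qed.

(** The linear span of the facet is everything: its direction space has
    dimension [d - 1], and a point of its affine hull lies outside that space
    because [u] takes the value -1 there. *)
Lemma facet_normal_spans u y : facet_normal P u ->
  (forall x, P x -> dot x u = -1 -> dot x y = 0) -> y = 0.
Proof.
case=> _ [_ [k [Pk [x0 [U [dU FU]]]]]] Fy.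
have dk := has_dim_full canonical_has_dim Pk.
have hull_dot z b : (forall x, P x -> dot x u = -1 -> dot x z = b) ->
    dot x0 z = b /\ forall v, v \in U -> dot v z = 0.
  move=> Fz; have hz x : x - x0 \in U -> dot x z = b.
    move=> xU; apply: (@affine_hull_hyperplane _ _ (P `&` [set x | dot x u = -1])).
      by move=> ? []; exact: Fz.
    by rewrite FU.
  have x0z : dot x0 z = b by apply: hz; rewrite subrr mem0v.
  split=> // v vU; have := hz (v + x0); rewrite addrK => /(_ vU).
  by rewrite dotDl x0z; lra.
have [x0u Uu] := hull_dot u (-1) (fun _ _ => id).
have [x0y Uy] := hull_dot y 0 Fy.
have x0U : x0 \notin U by apply/negP => /Uu; rewrite x0u; lra.
have UX : (U + <[x0]>)%VS = fullv.
  apply: full_dim_eq_fullv; rewrite dimv_disjoint_sum ?dU ?dim_vline.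
    suff -> : x0 != 0 by rewrite addn1.
    by apply: contraNneq x0U => ->; rewrite mem0v.
  apply/eqP; rewrite -subv0; apply/subvP => v; rewrite memv_cap => /andP[vU].
  case/vlineP => a va; move: vU; rewrite va memv0 => aU.
  have := Uu _ aU; rewrite dotZl x0u mulrN1 => /eqP; rewrite oppr_eq0 => /eqP ->.
  by rewrite scale0r.
apply/rowP => i; rewrite mxE -dot_delta.
have /memv_addP[v vU [w /vlineP[a ->] ->]] :
  delta_mx 0 i \in (U + <[x0]>)%VS by rewrite UX memvf.
by rewrite dotDl dotZl x0y Uy // mulr0 addr0.
Qed.

(** Choose linearly independent points [x_1, ..., x_d] of the facet.  On the
    dual polytope the functional [x_1 + ... + x_d] is at least [- d], with
    equality only if every [<x_i, y>] is -1, which determines [y]. *)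
Lemma facet_normal_vertex u : facet_normal P u -> vertex (dual_polytope P) u.
Proof.
move=> nu; have spF y : (forall x, (P `&` [set x | dot x u = -1]) x ->
    dot x y = 0) -> y = 0.
  by move=> Fy; apply: (facet_normal_spans nu) => x Px xu; apply: Fy.
have [X uX XF] := spanning_unitmx spF.
exists (\sum_i row i X), (\sum_(i < d) -1).
have dotX y : pairing y (\sum_i row i X) = \sum_i dot (row i X) y.
  by rewrite -[LHS]/(dot _ _) dotC dot_suml.
split=> [y Py|].
  by rewrite dotX; apply: ler_sum => i _; apply: Py; case: (XF i).
apply/seteqP; split=> [_ ->|y [Py]] /=.
  split; first exact: nu.1.
  by rewrite dotX; apply: eq_bigr => i _; case: (XF i).
rewrite dotX => /eqP sumX; apply: (unitmx_dot_inj uX) => i.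
rewrite (XF i).2; move: sumX; rewrite -subr_eq0 -sumrB psumr_eq0.
  by move=> /allP /(_ i (mem_index_enum _)) /=; lra.
by move=> j _; have := Py _ (XF j).1; rewrite -[pairing _ _]/(dot _ _); lra.
Qed.

Lemma facet_normal_lattice u : reflexive_polytope P -> facet_normal P u ->
  exists v, u = emb v.
Proof. by case=> _ lP /facet_normal_vertex/lP[v _ <-]; exists v. Qed.

Lemma facet_normal_bound u x : facet_normal P u -> P x -> -1 <= dot x u <= 1.
Proof.
case=> uP _ Px; have := uP _ Px; have := uP _ (symmetric_opp P_symmetric Px).
by rewrite dotNl; lra.
Qed.

End Facets.

(** * Existence of facets *)

Section AffineSpan.
Context {R : realType} {d : nat}.
Implicit Types (A F : set 'rV[R]_d) (x y u v : 'rV[R]_d).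

(** Closure under affine combinations of two points gives closure under affine
    combinations of any number of points: after translation by [a], sums are
    doubled midpoints. *)
Lemma affine_comb A n a (c : 'I_n -> R) (x : 'I_n -> 'rV[R]_d) :
  affine_set A -> A a -> (forall i, A (x i)) ->
  A (a + \sum_i c i *: (x i - a)).
Proof.
move=> aA Aa Ax; apply: (big_ind (fun v => A (a + v))) => [|v w Av Aw|i _].
- by rewrite addr0.
- have -> : a + (v + w) =
      2 *: (2^-1 *: (a + v) + (1 - 2^-1) *: (a + w)) + (1 - 2) *: a.
    by apply/rowP => j; rewrite !mxE; field.
  by apply: (aA) => //; apply: aA.
- have -> : a + c i *: (x i - a) = c i *: x i + (1 - c i) *: a.
    by apply/rowP => j; rewrite !mxE; ring.
  exact: aA.
Qed.

Lemma has_dim_hyperplane F u (X : 'M[R]_d) : (0 < d)%N ->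
  (forall x, F x -> dot x u = -1) -> X \in unitmx -> (forall i, F (row i X)) ->
  has_dim F d.-1.
Proof.
move=> d0 Fu uX FX; pose i0 := Ordinal d0.
have a_u : dot (row i0 X) u = -1 by apply: Fu.
pose f : 'Hom('rV[R]_d, 'M[R]_1) := linfun (mulmxr u^T).
have fE (v : 'rV[R]_d) : (v \in lker f) = (dot v u == 0).
  rewrite memv_ker lfunE /=; apply/eqP/eqP => [vu|vu].
    by rewrite -[v](row_id 0) -mulmx_tr_dot vu mxE.
  by apply: mulmx_tr_eq0 => i; rewrite row_id.
exists (row i0 X), (lker f); split.
  have := limg_ker_dim f fullv; rewrite capfv dimvf dim_matrix.
  suff -> : \dim (limg f) = 1%N by move: (\dim _) => n; lia.
  apply/eqP; rewrite eqn_leq lt0n dimv_eq0; apply/andP; split.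
    by apply: leq_trans (dimvS (subvf _)) _; rewrite dimvf dim_matrix.
  apply: contraNneq (oner_neq0 R) => f0; rewrite -oppr_eq0 -a_u -fE memv_ker.
  by rewrite -memv0 -f0 memv_img ?memvf.
apply/seteqP; split=> x /=.
  by move=> /(affine_hull_hyperplane Fu) xu; rewrite fE dotBl xu a_u subrr.
rewrite fE dotBl a_u opprK => /eqP xu.
pose c := x *m invmx X.
have xE : x = \sum_i c 0 i *: row i X by rewrite -mulmx_sum_row mulmxKV.
have c1 : \sum_i c 0 i = 1.
  have : dot x u = - \sum_i c 0 i by
    rewrite {1}xE dot_suml -sumrN; apply: eq_bigr => i _; rewrite dotZl Fu ?mulrN1.
  lra.
have -> : x = row i0 X + \sum_i c 0 i *: (row i X - row i0 X).
  rewrite (eq_bigr (fun i => c 0 i *: row i X - c 0 i *: row i0 X)).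
    by rewrite sumrB -xE -scaler_suml c1 scale1r addrC subrK.
  by move=> i _; rewrite scalerBr.
apply: (@affine_comb (affine_hull F)) => [|| i]; first exact: affine_hull_affine.
  exact: sub_gen_smallest.
exact: sub_gen_smallest.
Qed.

End AffineSpan.

Lemma seq_argmin (R : realDomainType) (T : eqType) (f : T -> R) (p : pred T) s :
  has p s -> exists2 x, x \in s & p x /\ forall y, y \in s -> p y -> f x <= f y.
Proof.
elim: s => //= a s IH; have [/IH[x xs [px xmin]] _|nps] := boolP (has p s).
  have [/andP[pa fax]|ax] := boolP (p a && (f a <= f x)).
    exists a; rewrite ?mem_head //; split=> // y; rewrite inE => /predU1P[-> //|ys py].
    exact: le_trans fax (xmin y ys py).
  exists x; rewrite ?inE ?xs ?orbT //; split=> // y; rewrite inE => /predU1P[->|].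
    by move=> pa; move: ax; rewrite pa -ltNge => /ltW.
  exact: xmin.
rewrite orbF => pa; exists a; rewrite ?mem_head //; split=> // y.
rewrite inE => /predU1P[-> //|ys py]; case/negP: nps.
by apply/hasP; exists y.
Qed.

Section FacetExistence.
Context {R : realType} {d : nat} {P : set 'rV[R]_d}.
Hypotheses (P_canonical : canonical_fano P) (P_symmetric : centrally_symmetric P).
Implicit Types (x y z u v : 'rV[R]_d).

Lemma canonical_spans v : (forall x, P x -> dot x v = 0) -> v = 0.
Proof.
move=> Pv; have [x0 [U [/full_dim_eq_fullv -> PU]]] := canonical_has_dim P_canonical.
apply/rowP => i; rewrite mxE -dot_delta.
by apply: (affine_hull_hyperplane Pv); rewrite PU /= memvf.
Qed.

Variable s : seq 'rV[R]_d.
Hypothesis Ps : P = convex_hull [set` s].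

Lemma generator_neg v : v != 0 -> exists2 x, x \in s & dot x v < 0.
Proof.
move=> v0; apply: contrapT => noneg; move/eqP: v0; apply; apply: canonical_spans.
have Pge x : P x -> 0 <= dot x v.
  rewrite Ps; apply: convex_hull_halfspace => y ys.
  by rewrite leNgt; apply/negP => yv; apply: noneg; exists y.
move=> x Px; apply/eqP; rewrite eq_le Pge // andbT -oppr_ge0 -dotNl.
by apply: Pge; exact: symmetric_opp.
Qed.

(** Moving from a point [y] of the dual polytope in a direction that keeps all
    tight constraints tight, one stops at the first new constraint.  It exists
    because the direction is negative on some generator of [P]. *)
Lemma pivot y v : (forall x, x \in s -> -1 <= dot x y) -> v != 0 ->
  (forall x, x \in s -> dot x y = -1 -> dot x v = 0) ->
  exists2 t, 0 < t & (forall x, x \in s -> -1 <= dot x (y + t *: v)) /\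
    exists2 x, x \in s & dot x (y + t *: v) = -1 /\ dot x v != 0.
Proof.
move=> sy v0 sv; have [x0 x0s x0v] := generator_neg v0.
(* [f x] is the step length at which the constraint of [x] becomes tight. *)
pose f x := (1 + dot x y) / - dot x v.
have [x xs [xv xmin]] : exists2 x, x \in s & dot x v < 0 /\
    forall w, w \in s -> dot w v < 0 -> f x <= f w.
  by apply: (seq_argmin f (p := fun x => dot x v < 0)); apply/hasP; exists x0.
have tE : f x * dot x v = - (1 + dot x y) by rewrite /f; field; rewrite lt_eqF.
have t0 : 0 < f x.
  apply: divr_gt0; rewrite ?oppr_gt0 //.
  rewrite addrC -[1]opprK subr_gt0 lt_neqAle sy // andbT.
  by apply: contraTneq xv => /esym/(sv _ xs) ->; rewrite ltxx.
exists (f x) => //; split=> [w ws|].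
  rewrite dotDr dotZr; have [wv|wv] := ltP (dot w v) 0.
    have := xmin _ ws wv; rewrite {2}/f ler_pdivlMr ?oppr_gt0 //; lra.
  by have := sy _ ws; have := mulr_ge0 (ltW t0) wv; lra.
exists x => //; rewrite lt_eqF //; split=> //.
by rewrite dotDr dotZr tE; ring.
Qed.

(** The walk of the simplex method on the dual polytope: while the tight
    constraints do not span, move along a direction orthogonal to the chosen
    ones on which [z] does not increase.  Each step enlarges the chosen
    independent family of tight constraints. *)
Lemma tight_basis k y (X : 'M[R]_(k, d)) z : (k <= d)%N ->
  (forall x, x \in s -> -1 <= dot x y) -> dot z y < 0 -> row_free X ->
  (forall i, row i X \in s /\ dot (row i X) y = -1) ->
  exists u (Y : 'M[R]_d), [/\ forall x, x \in s -> -1 <= dot x u, dot z u < 0,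
    Y \in unitmx & forall i, row i Y \in s /\ dot (row i Y) u = -1].
Proof.
have [n] := ubnP (d - k); elim: n k y X => // n IH k y X nk kd sy zy fX Xy.
have [dk|kltd] := leqP d k.
  have kE : k = d by apply/eqP; rewrite eqn_leq kd.
  move: X fX Xy; rewrite kE => X fX Xy.
  by exists y, X; split; rewrite // -row_free_unit.
have [v0 v0n0 Xv0] := common_orthogonal X kltd.
(* The opposite direction serves as well, so [z] may be assumed nonpositive on it. *)
have [v [vn0 Xv zv]] : exists v, [/\ v != 0,
    forall i, dot (row i X) v = 0 & dot z v <= 0].
  have [zv|zv] := leP (dot z v0) 0; first by exists v0.
  exists (- v0); split=> [|i|]; first by rewrite oppr_eq0.
    by rewrite dotNr Xv0 oppr0.
  by rewrite dotNr oppr_le0 ltW.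
have step t x : 0 <= t -> (forall w, w \in s -> -1 <= dot w (y + t *: v)) ->
    x \in s -> dot x (y + t *: v) = -1 -> dot x v != 0 ->
    exists u (Y : 'M[R]_d), [/\ forall x, x \in s -> -1 <= dot x u, dot z u < 0,
      Y \in unitmx & forall i, row i Y \in s /\ dot (row i Y) u = -1].
  move=> t0 sty xs xy xv.
  apply: (IH (k + 1)%N (y + t *: v) (col_mx X x)) => //; try by lia.
  - rewrite dotDr dotZr; have := mulr_ge0_le0 t0 zv; lra.
  - exact: row_free_col_mx_dot xv.
  - apply: (@col_mx_rows _ _ _ X x
      [set w | w \in s /\ dot w (y + t *: v) = -1]) => //= i.
    by rewrite dotDr dotZr Xv mulr0 addr0; exact: Xy.
(* A constraint that is already tight and not orthogonal to [v] needs no move. *)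
have [[x [xs [xy xv]]]|tight] := pselect
    (exists x, x \in s /\ (dot x y = -1 /\ dot x v != 0)).
  by apply: (step 0 x); rewrite ?scale0r ?addr0.
have [t t0 [sty [x xs [xy xv]]]] : exists2 t, 0 < t &
    (forall x, x \in s -> -1 <= dot x (y + t *: v)) /\
    exists2 x, x \in s & dot x (y + t *: v) = -1 /\ dot x v != 0.
  apply: pivot => // x xs xy; apply/eqP/negPn/negP => xv.
  by apply: tight; exists x.
exact: (step t x (ltW t0)).
Qed.

(** A first step in the direction [- z] makes [z] negative on a point of the
    dual polytope; walking on until the tight constraints contain a basis keeps
    it negative, and a point of the dual polytope tight on a basis is the normal
    of a facet. *)
Lemma hull_facet_normal_neg z : z != 0 ->
  exists2 u, facet_normal P u & dot z u < 0.
Proof.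
move=> z0.
have nz0 : - z != 0 by rewrite oppr_eq0.
have dgt0 : (0 < d)%N by case/rV0Pn: z0 => i _; apply: leq_ltn_trans (ltn_ord i).
have zz : 0 < dot z z.
  rewrite lt_neqAle sumr_ge0 ?andbT => [|i _]; last exact: sqr_ge0.
  apply: contra z0 => /eqP/esym/eqP; rewrite psumr_eq0 => [/allP h|i _].
    apply/eqP/rowP => i; rewrite mxE; apply/eqP.
    by have := h i (mem_index_enum _); rewrite /= mulf_eq0 orbb.
  exact: sqr_ge0.
have [||t t0 [sy _]] := @pivot 0 (- z) _ nz0.
- by move=> x _; rewrite dot0r; lra.
- by move=> x _; rewrite dot0r; lra.
rewrite add0r in sy.
have zy : dot z (t *: - z) < 0 by rewrite dotZr dotNr mulrN oppr_lt0 mulr_gt0.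
have free0 : row_free (0 : 'M[R]_(0, d)) by rewrite /row_free mxrank0.
have [|u [Y [su zu uY Yu]]] := tight_basis (leq0n d) sy zy free0; first by case.
exists u => //; split.
  by rewrite Ps; apply: convex_hull_halfspace.
split.
  exists u, (-1); split=> // x.
  by rewrite Ps; move: x; apply: convex_hull_halfspace.
exists d.-1; rewrite prednK //; split; first exact: canonical_has_dim.
apply: (@has_dim_hyperplane _ _ _ u Y) => // [x []//|i].
by split=> /=; [rewrite Ps; apply: sub_gen_smallest; case: (Yu i)|case: (Yu i)].
Qed.

End FacetExistence.

Lemma facet_normal_neg (R : realType) d (P : set 'rV[R]_d) z :
  canonical_fano P -> centrally_symmetric P -> z != 0 ->
  exists2 u, facet_normal P u & dot z u < 0.
Proof.
move=> cP sP; have [S /finite_seqP[s ->] Ps] := canonical_polytope cP.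
exact: (hull_facet_normal_neg cP sP Ps).
Qed.

(** * Lattice points of facets *)

Section FacetCounts.
Context {R : realType} {d : nat} {P : set 'rV[R]_d}.
Hypotheses (P_canonical : canonical_fano P) (P_symmetric : centrally_symmetric P).
Notation emb := (@lattice_emb R d).

Lemma facet_normal_neq0 u : facet_normal P u -> u != 0.
Proof.
move=> nu; apply/eqP => u0; have d0 := facet_normal_dim P_canonical nu.
have : const_mx 1 = 0 :> 'rV[R]_d.
  apply: (facet_normal_spans P_canonical nu) => x _.
  by rewrite u0 dot0r; lra.
by move=> /rowP/(_ (Ordinal d0)); rewrite !mxE => /eqP; rewrite oner_eq0.
Qed.

(** Differences of lattice points of a facet are orthogonal to its normal, so
    modulo 3 they all lie in one hyperplane. *)
Lemma card_residues_facet F : facet P F -> (#|residues F| <= 3 ^ d.-1)%N.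
Proof.
move=> /(facet_has_normal P_canonical P_symmetric)[u nu FE].
have [->|/set0Pn[_ /residuesP[m0 [Fm0 _]]]] := eqVneq (residues F) finset.set0.
  by rewrite cards0.
have [] := @annihilated_mod3 R d [set m - m0 | m in [set m | F (emb m)]] u.
- exact: facet_normal_neq0.
- move=> _ [m /= Fm <-]; move: Fm Fm0; rewrite FE => -[_ mu] [_ m0u].
  by rewrite embB dotBl mu m0u subrr.
move=> v v0 Fv.
rewrite -(card_hyperplane (dot (red m0) v) v0); apply/subset_leq_card/fintype.subsetP.
move=> _ /residuesP[m [Fm <-]]; rewrite inE -subr_eq0 -dotBl -map_mxB.
by apply/eqP/Fv; exists m.
Qed.

Lemma dot_emb_bound u m : facet_normal P (emb u) -> P (emb m) ->
  -1 <= dot m u <= 1.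
Proof.
move=> nu Pm; have := facet_normal_bound P_symmetric nu Pm.
by rewrite dot_emb -(ler_int R) -(ler_int R _ 1) rmorphN.
Qed.

(** A normal divisible by 3 would vanish on all lattice points of [P], since it
    only takes the values -1, 0, 1 there; but their residues are not contained in
    a hyperplane. *)
Lemma red_normal_neq0 u : residues P = [set: _]%SET -> facet_normal P (emb u) ->
  red u != 0.
Proof.
move=> PT nu; apply/eqP => u0.
have [] := @annihilated_mod3 R d [set m | P (emb m)] (emb u).
- exact: facet_normal_neq0.
- move=> m Pm; rewrite dot_emb (_ : dot m u = 0) //.
  apply: intF3_inj; [exact: dot_emb_bound | by [] | ].
  by rewrite red_dot u0 dot0r.
move=> v v0 Pv; have [c cv] := dot_surj 1 v0.
have : c \in residues P by rewrite PT inE.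
by case/residuesP => m [Pm mc]; have /eqP := Pv m Pm; rewrite mc cv oner_eq0.
Qed.

Lemma card_residues_facet_full F : reflexive_polytope P -> residues P = [set: _]%SET ->
  facet P F -> #|residues F| = (3 ^ d.-1)%N.
Proof.
move=> rP PT fF; apply/eqP; rewrite eqn_leq card_residues_facet //=.
have [u0 nu FE] := facet_has_normal P_canonical P_symmetric fF.
have [u uE] := facet_normal_lattice P_canonical rP nu; rewrite {}uE in nu FE.
rewrite -(card_hyperplane (-1) (red_normal_neq0 PT nu)).
apply/subset_leq_card/fintype.subsetP => c; rewrite inE => /eqP cu.
have : c \in residues P by rewrite PT inE.
case/residuesP => m [Pm mc]; rewrite -mc; apply: mem_residues; rewrite FE.
split=> //=; rewrite dot_emb (_ : dot m u = -1) ?rmorphN //.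
by apply: intF3_inj; [exact: dot_emb_bound | by [] | rewrite red_dot mc cu].
Qed.

End FacetCounts.

(** * Facets with the maximal number of lattice points *)

Lemma row_free_dot_surj (K : fieldType) k d (X : 'M[K]_(k, d)) (g : 'I_k -> K) :
  row_free X -> exists c, forall i, dot (row i X) c = g i.
Proof.
case/row_freeP => B XB; exists (B *m \col_i g i)^T => i.
by rewrite -mulmx_tr_dot trmxK mulmxA XB mul1mx mxE.
Qed.

(** The normal of a facet on which every residue allowed by the normal is
    attained by a lattice point. *)
Definition full_normal (R : realType) d (P : set 'rV[R]_d) (u : 'rV[int]_d) :=
  [/\ forall x, P x -> -1 <= dot x (lattice_emb R u) <= 1, red u != 0 &
    forall c, dot c (red u) = -1 ->
      exists m, [/\ P (lattice_emb R m), red m = c & dot m u = -1]].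

Section FullNormals.
Context {R : realType} {d : nat} {P : set 'rV[R]_d}.
Hypotheses (P_canonical : canonical_fano P) (P_symmetric : centrally_symmetric P).
Implicit Types (u w m : 'rV[int]_d).
Notation emb := (@lattice_emb R d).

Lemma full_normal_bound u m : full_normal P u -> P (emb m) -> -1 <= dot m u <= 1.
Proof.
case=> uP _ _ /uP.
by rewrite dot_emb -(ler_int R) -(ler_int R _ 1) rmorphN.
Qed.

Lemma full_normal_value u m a : full_normal P u -> P (emb m) -> -1 <= a <= 1 ->
  dot (red m) (red u) = a%:~R -> dot m u = a.
Proof.
move=> fu Pm a1 mu; apply: intF3_inj => //; first exact: full_normal_bound.
by rewrite red_dot.
Qed.

Lemma full_normal_opp u : full_normal P u -> full_normal P (- u).
Proof.
move=> [uP u0 ufull]; split=> [x Px||c].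
- by have := uP x Px; rewrite embN dotNr; lra.
- by rewrite map_mxN oppr_eq0.
rewrite map_mxN dotNr -dotNl => /ufull[m [Pm mc mu]]; exists (- m); split.
- by rewrite embN; exact: symmetric_opp.
- by rewrite map_mxN mc opprK.
- by rewrite dotNl dotNr opprK.
Qed.

Lemma facet_full_normal u : facet_normal P (emb u) ->
  #|residues (P `&` [set x | dot x (emb u) = -1])| = (3 ^ d.-1)%N ->
  full_normal P u.
Proof.
move=> nu cF; set F := P `&` _ in cF.
have FP m : F (emb m) -> P (emb m) /\ dot m u = -1.
  case=> Pm /= mu; split=> //; apply/eqP.
  by rewrite -(eqr_int R) rmorphN -mu dot_emb.
have u0 : red u != 0.
  have : (0 < #|residues F|)%N by rewrite cF expn_gt0.
  case/card_gt0P => _ /residuesP[m [/FP[_ mu] _]]; apply/eqP => u0.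
  by have := red_dot m u; rewrite mu u0 dot0r; move/eqP; rewrite intF3_eq0.
have FE : residues F = [set c | dot c (red u) == -1]%SET.
  apply/eqP; rewrite eqEcard cF (card_hyperplane _ u0) leqnn andbT.
  apply/fintype.subsetP => _ /residuesP[m [/FP[_ mu] <-]].
  by rewrite inE -red_dot mu rmorphN.
split=> // [x Px|c cu]; first exact: (facet_normal_bound P_symmetric nu).
have : c \in residues F by rewrite FE inE cu.
by case/residuesP => m [/FP[Pm mu] mc]; exists m.
Qed.

(** On the lattice points of the facet of [u], the normal [w] is congruent to
    -1, hence equal to -1.  So [w - u] vanishes on them, and if it were nonzero
    the affine hyperplane [<c, u> = -1] of [F_3^d] would coincide with a linear
    one. *)
Lemma full_normal_red_inj u w :
  full_normal P u -> full_normal P w -> red u = red w -> u = w.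
Proof.
move=> fu fw uw; apply/eqP; rewrite eq_sym -subr_eq0; apply/negPn/negP => wu0.
have [_ u0 ufull] := fu.
have [||v v0 Av] := @annihilated_mod3 R d
    [set m | P (emb m) /\ dot m u = -1] (emb (w - u)).
- by apply/eqP; rewrite -(emb0 R) => /emb_inj wuE; rewrite wuE eqxx in wu0.
- move=> m [Pm mu]; rewrite dot_emb dotBr mu.
  rewrite (@full_normal_value w m (-1)) // -uw -red_dot mu //.
have sub : [set c | dot c (red u) == -1]%SET \subset [set c | dot c v == 0]%SET.
  apply/fintype.subsetP => c; rewrite !inE => /eqP /ufull[m [Pm <- mu]].
  by rewrite Av.
have {sub} /eqP uv : [set c | dot c (red u) == -1]%SET == [set c | dot c v == 0]%SET.
  by rewrite eqEcard sub !card_hyperplane ?leqnn.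
have [c cu] := dot_surj (-1) u0.
have : c \in [set c | dot c (red u) == -1]%SET by rewrite inE cu.
rewrite uv inE => /eqP cv.
have : - c \in [set c | dot c v == 0]%SET by rewrite inE dotNl cv oppr0.
by rewrite -uv inE dotNl cu opprK.
Qed.

Lemma barycenter_mem x y z : P (emb x) -> P (emb y) -> P (emb z) ->
  red (x + y + z) = 0 -> exists2 m, P (emb m) & x + y + z = m *+ 3.
Proof.
move=> Px Py Pz; rewrite -(map_mx0 (intr : {rmorphism int -> 'F_3})) => /red_eqP[m].
rewrite add0r => xyz; exists m => //.
have -> : emb m = (2 / 3) *: (2^-1 *: emb x + (1 - 2^-1) *: emb y)
    + (1 - 2 / 3) *: emb z.
  move/(congr1 emb): xyz; rewrite emb_mulrn !embD => /rowP xyz.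
  by apply/rowP => i; have := xyz i; rewrite !mxE; lra.
have cP := polytope_convex (canonical_polytope P_canonical).
by apply: (cP) => //; [lra | apply: cP => //; lra].
Qed.

Lemma F3_sign (a : 'F_3) : a != 0 -> exists2 e : int, a = e%:~R & e = 1 \/ e = -1.
Proof.
case: (F3_cases a) => ->; rewrite ?eqxx // => _; [exists 1 | exists (-1)] => //.
  by left.
by right.
Qed.

(** Let [u_i, u_j] be rows with nonzero coefficients.  On the facet of [u_i]
    choose lattice points [x, y, z] at which [u_j] is 1, -1, 0 and the other rows
    are 0.  Modulo 3 the values of [w] on them are distinct, so they are -1, 0, 1
    in some order, and [w] is 0 at the barycenter.  But there only [u_i] is
    nonzero among the rows, so [w] is nonzero modulo 3. *)
Lemma full_normal_support k (U : 'M[int]_(k, d)) w (a : 'rV['F_3]_k) i j :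
  row_free (red U) -> (forall l, full_normal P (row l U)) -> full_normal P w ->
  red w = a *m red U -> a 0 i != 0 -> j != i -> a 0 j = 0.
Proof.
move=> freeU fU fw wa ai ji; apply/eqP/negPn/negP => aj.
have [ei aiE eiP] := F3_sign ai; have [ej ajE ejP] := F3_sign aj.
(* Prescribed values: [b] at [i], [c] at [j], 0 elsewhere. *)
pose g (b c : int) l : int := if l == i then b else if l == j then c else 0.
have gi b c : g b c i = b by rewrite /g eqxx.
have gj b c : g b c j = c by rewrite /g (negPf ji) eqxx.
have w_dot m b c : (forall l, dot (red m) (red (row l U)) = (g b c l)%:~R) ->
    (3 %| dot m w - (ei * b + ej * c))%Z.
  move=> mU; rewrite -intF3_eq0 rmorphB /= red_dot wa dotC dot_mulmxl.
  rewrite (bigD1 i) //= (bigD1 j) //= big1 => [|l /andP[li lj]].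
    rewrite -!map_row !(dotC _ (red m)) !mU gi gj aiE ajE addr0.
    by rewrite !rmorphD !rmorphM subrr.
  by rewrite -map_row dotC mU /g (negPf li) (negPf lj) mulr0.
have [cx cxE] := row_free_dot_surj (fun l => (g (-1) 1 l)%:~R) freeU.
have [cz czE] := row_free_dot_surj (fun l => (g (-1) 0 l)%:~R) freeU.
(* The sum is zero by construction, and [- (-1 - 1) = -1] modulo 3 at [i]. *)
pose cy := - (cx + cz).
have cyE l : dot (row l (red U)) cy = (g (-1) (-1) l)%:~R.
  rewrite dotNr dotDr cxE czE /g; case: (l == i); first exact: val_inj.
  by case: (l == j); exact: val_inj.
have lift c b : (forall l, dot (row l (red U)) c = (g (-1) b l)%:~R) ->
    -1 <= b <= 1 ->
    exists m, [/\ P (emb m), red m = c, forall l, dot m (row l U) = g (-1) b l &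
      (3 %| dot m w - (- ei + ej * b))%Z].
  move=> cE b1; have [_ _ /(_ c)] := fU i.
  rewrite map_row dotC cE gi rmorphN => /(_ erefl)[m [Pm mc _]].
  have mU l : dot (red m) (red (row l U)) = (g (-1) b l)%:~R.
    by rewrite mc map_row dotC cE.
  exists m; split=> // [l|].
    apply: full_normal_value => //; rewrite /g.
    by case: (l == i) => //; case: (l == j).
  by rewrite -[- ei]mulrN1; exact: w_dot.
have [||x [Px xc xU xw]] := lift cx 1 => //.
have [||y [Py yc yU yw]] := lift cy (-1) => //.
have [||z [Pz zc zU zw]] := lift cz 0 => //.
have [|m Pm xyz] := barycenter_mem Px Py Pz.
  by rewrite !map_mxD xc yc zc /cy opprD; apply/rowP => l; rewrite !mxE; ring.
(* The barycenter [m] has values -1 at [i], 0 at [j] and elsewhere. *)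
have dot3 v : 3 * dot m v = dot x v + dot y v + dot z v.
  by rewrite -!dotDl xyz -scaler_nat dotZl.
have mU l : dot m (row l U) = g (-1) 0 l.
  by have := dot3 (row l U); rewrite xU yU zU /g; case: ifP => _; [|case: ifP => _]; lia.
have mw : (3 %| dot m w - (ei * -1 + ej * 0))%Z.
  by apply: w_dot => l; rewrite -red_dot mU.
have := dot3 w; have := full_normal_bound fw Px; have := full_normal_bound fw Py.
have := full_normal_bound fw Pz.
case/dvdzP: xw => qx; case/dvdzP: yw => qy; case/dvdzP: zw => qz.
case/dvdzP: mw => qm; case: eiP => ->; case: ejP => ->; lia.
Qed.

End FullNormals.

(** * Recognition of the cube *)

Section CubeHull.
Context {R : realType} {d : nat}.

(** Induction on the number [k] of leading coordinates that are allowed to be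
    different from 1 and -1. *)
Lemma cube_sub_convex (A : set 'rV[R]_d) :
  (forall x y t, 0 <= t <= 1 -> A x -> A y -> A (t *: x + (1 - t) *: y)) ->
  (forall a : 'rV[int]_d, (forall i, a 0 i = 1 \/ a 0 i = -1) ->
    A (lattice_emb R a)) ->
  cube `<=` A.
Proof.
move=> cA Ac.
suff H k : forall x : 'rV[R]_d, cube x ->
    (forall i : 'I_d, (k <= i)%N -> x 0 i = 1 \/ x 0 i = -1) -> A x.
  by move=> x cx; apply: (H d) => // i; rewrite leqNgt ltn_ord.
elim: k => [|k IH] x cx xk.
  have -> : x = lattice_emb R (\row_i if x 0 i == 1 then 1 else -1).
    apply/rowP => i; rewrite !mxE; case: eqP => [-> //|].
    by case: (xk i (leq0n _)) => // -> _; rewrite rmorphN.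
  by apply: Ac => i; rewrite mxE; case: ifP; [left | right].
pose y (b : R) := \row_(i < d) if i == k :> nat then b else x 0 i.
have yP b : b = 1 \/ b = -1 -> A (y b).
  move=> b1; apply: IH => i; rewrite mxE; case: ifP => // ik.
    by case: b1 => ->; lra.
  by move=> ki; apply: xk; rewrite ltn_neqAle eq_sym ik.
have [kd|dk] := ltnP k d; last first.
  by apply: IH => // i ki; have := ltn_ord i; lia.
pose t := (1 + x 0 (Ordinal kd)) / 2.
have -> : x = t *: y 1 + (1 - t) *: y (-1).
  apply/rowP => i; rewrite !mxE; case: eqP => ik; last by ring.
  by rewrite (_ : i = Ordinal kd) /t; [field | exact: val_inj].
apply: cA; [|by apply: yP; left|by apply: yP; right].
by have := cx (Ordinal kd); rewrite /t; lra.
Qed.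

End CubeHull.

Section Recognition.
Context {R : realType} {d : nat} {P : set 'rV[R]_d}.
Hypotheses (P_canonical : canonical_fano P) (P_symmetric : centrally_symmetric P).
Notation emb := (@lattice_emb R d).

(** Greedy choice: a full normal [w] that is not orthogonal to a vector [z]
    orthogonal to all chosen ones is independent of them modulo 3, for otherwise
    [w] would be plus or minus one of them and orthogonal to [z]. *)
Lemma independent_full_normals :
  (forall z : 'rV[R]_d, z != 0 ->
    exists2 w, full_normal P w & dot z (emb w) != 0) ->
  exists2 U : 'M[int]_d, red U \in unitmx & forall l, full_normal P (row l U).
Proof.
move=> fullP.
suff /(_ d (leqnn d)) [U fU UP] : forall k, (k <= d)%N ->
    exists2 U : 'M[int]_(k, d), row_free (red U) &
      forall l, full_normal P (row l U).
  by exists U; rewrite // -row_free_unit.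
elim=> [|k IH] kd.
  by exists 0 => [|[]//]; rewrite map_mx0 /row_free mxrank0.
have [U fU UP] := IH (ltnW kd).
have [z z0 Uz] := common_orthogonal (map_mx (intr : int -> R) U) kd.
have [w wP zw] := fullP z z0.
rewrite -addn1; exists (col_mx U w); last first.
  move=> l; case: (split_ordP l) => j ->; first by rewrite rowKu.
  by rewrite rowKd row_id.
rewrite map_col_mx; apply: row_free_col_mx => //.
apply/negP => /submxP[a wa]; have [_ w0 _] := wP.
have [i ai] : exists i, a 0 i != 0.
  by apply/rV0Pn; apply: contraNneq w0 => a0; rewrite wa a0 mul0mx.
have {}wa : red w = a 0 i *: red (row i U).
  rewrite wa mulmx_sum_row (bigD1 i) //= big1 ?addr0 ?map_row // => j ji.
  by rewrite (full_normal_support P_canonical fU UP wP wa ai ji) scale0r.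
move/eqP: zw; apply; have Uzi := Uz i; rewrite -map_row in Uzi.
have := F3_cases (a 0 i) => -[aE|aE|aE]; first by rewrite aE eqxx in ai.
  rewrite (full_normal_red_inj (UP i) wP) in Uzi; first by rewrite dotC.
  by rewrite wa aE scale1r.
rewrite -[w]opprK -(full_normal_red_inj (UP i) (full_normal_opp P_symmetric wP)).
  by rewrite embN dotNr dotC Uzi oppr0.
by rewrite map_mxN wa aE scaleN1r opprK.
Qed.

(** Up to sign [a] has an entry -1.  The facet of that normal attains the
    residue prescribed by [a], and values in -1, 0, 1 are determined by their
    residues. *)
Lemma full_normals_realize (U : 'M[int]_d) (a : 'rV[int]_d) i :
  red U \in unitmx -> (forall l, full_normal P (row l U)) ->
  (forall l, -1 <= a 0 l <= 1) -> a 0 i != 0 ->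
  exists2 m, P (emb m) & m *m U^T = a.
Proof.
move=> uU UP; wlog ai : a / a 0 i = -1.
  move=> wl a1 ai; have [ai1|ai1] : a 0 i = -1 \/ a 0 i = 1.
    by have := a1 i; move/eqP: ai; lia.
    exact: wl.
  have [|l||m Pm mU] := wl (- a); rewrite ?mxE ?ai1 //.
    by rewrite lerN2 lerNl andbC.
  exists (- m); first by rewrite embN; exact: symmetric_opp.
  by rewrite mulNmx mU opprK.
move=> a1 _; have freeU : row_free (red U) by rewrite row_free_unit.
have [c cE] := row_free_dot_surj (fun l => (a 0 l)%:~R) freeU.
have [_ _ /(_ c)] := UP i.
rewrite map_row dotC cE ai rmorphN => /(_ erefl)[m [Pm mc _]].
exists m => //; apply/rowP => l.
rewrite mulmx_trE; apply: full_normal_value (UP l) Pm (a1 l) _.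
by rewrite mc map_row dotC cE.
Qed.

(** The coordinates [<x, u_l>] map [P] into the cube.  They are unimodular
    because the unit vectors are attained at lattice points, and onto because the
    corners are attained by points of the convex set [P]. *)
Lemma full_normals_cube (U : 'M[int]_d) :
  red U \in unitmx -> (forall l, full_normal P (row l U)) ->
  lattice_isomorphic P cube.
Proof.
move=> uU UP.
have realize := full_normals_realize uU UP.
(* Realising the unit vectors gives an integral inverse. *)
have uUT : U^T \in unitmx.
  have /choice[m mP] (l : 'I_d) : exists m, m *m U^T = delta_mx 0 l :> 'rV[int]_d.
    have [i||m _ mU] := realize (delta_mx 0 l) l; last by exists m.
      by rewrite mxE eqxx /=; case: eqP.
    by rewrite mxE !eqxx.
  have : (\matrix_l m l) *m U^T = 1%:M.
    by apply/row_matrixP => l; rewrite row_mul rowK mP row1.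
  by case/mulmx1_unit.
pose UR := map_mx (intr : int -> R) U.
exists (mulmxr U^T), (mulmxr UR^T); split.
- exists (mulmxr (invmx U^T)) => m /=; first exact: mulmxK.
  exact: mulmxKV.
- by move=> m /=; rewrite /lattice_emb map_mxM map_trmx.
have gE x l : (x *m UR^T) 0 l = dot x (emb (row l U)).
  by rewrite mulmx_trE -map_row.
apply/seteqP; split=> [_ [x Px <-] l /=|].
  by rewrite gE; case: (UP l) => + _ _; apply.
apply: cube_sub_convex => [_ _ t t01 [x Px <-] [y Py <-]|a a1].
  exists (t *: x + (1 - t) *: y); last by rewrite linearD !linearZ.
  exact: (polytope_convex (canonical_polytope P_canonical)).
suff [m Pm mU] : exists2 m, P (emb m) & m *m U^T = a.
  exists (emb m) => //=; rewrite -mU /lattice_emb map_mxM map_trmx //.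
have [d0|d0] := posnP d.
  exists 0; first by rewrite emb0; exact: canonical_mem0.
  by apply/rowP => i; have := ltn_ord i; rewrite {2}d0.
apply: (realize a (Ordinal d0)) => [l|].
  by case: (a1 l) => ->.
by case: (a1 (Ordinal d0)) => ->.
Qed.

(** Lift each residue to a vector with entries -1, 0, 1 and pull it back to a
    lattice point of [P]; distinct lattice points of [P] have distinct
    residues. *)
Lemma isomorphic_cube_residues : lattice_isomorphic P cube ->
  (3 ^ d <= #|residues P|)%N.
Proof.
case=> f [g [[f' fK f'K] gf gP]].
have g_inj : injective g.
  have /mulmx1_unit[_ uG] :
      (\matrix_i emb (f' (delta_mx 0 i))) *m lin1_mx g = 1%:M.
    apply/row_matrixP => i; rewrite row_mul rowK mul_rV_lin1 gf f'K row1.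
    by apply/rowP => j; rewrite !mxE; case: (_ && _).
  by move=> x y; rewrite -!mul_rV_lin1 => /(can_inj (mulmxK uG)).
have /choice[r rP] (b : 'F_3) : exists z : int, z%:~R = b /\ -1 <= z <= 1.
  by case: (F3_cases b) => ->; [exists 0 | exists 1 | exists (-1)].
pose m (c : 'rV['F_3]_d) := f' (map_mx r c).
have Pm c : P (emb (m c)).
  have : cube (emb (map_mx r c)).
    move=> i; rewrite !mxE; have [_ /andP[r1 r2]] := rP (c 0 i).
    rewrite -(ler_int R) rmorphN in r1; rewrite -(ler_int R) in r2.
    by rewrite r1.
  by rewrite -gP -[map_mx r c]f'K -gf => -[x Px /g_inj <-].
have m_inj : injective (fun c => red (m c)).
  move=> b c /(red_inj P_canonical P_symmetric (Pm b) (Pm c)).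
  move/(can_inj f'K) => /rowP bc; apply/rowP => i.
  by have := bc i; rewrite !mxE => /(congr1 (intr : int -> 'F_3)); rewrite !(rP _).1.
have -> : (3 ^ d = #|[set red (m c) | c in [set: 'rV['F_3]_d]]%SET|)%N.
  by rewrite card_imset // cardsT card_mx card_Fp // mul1n.
apply/subset_leq_card/fintype.subsetP => _ /imsetP[c _ ->].
exact: mem_residues.
Qed.

End Recognition.

Theorem theorem6p4 (R : realType) (d : nat) (P : set 'rV[R]_d)
    (P_canonical : canonical_fano P) (P_symmetric : centrally_symmetric P) :
  [/\ P `&` lattice #<= `I_(3 ^ d)%N,
      forall F : set 'rV[R]_d,
        facet P F -> F `&` lattice #<= `I_(3 ^ d.-1)%N &
      reflexive_polytope P ->
      [<-> P `&` lattice #= `I_(3 ^ d)%N;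
           forall F : set 'rV[R]_d,
             facet P F -> F `&` lattice #= `I_(3 ^ d.-1)%N;
           lattice_isomorphic P cube]].
Proof.
have cardT : #|{: 'rV['F_3]_d}| = (3 ^ d)%N by rewrite card_mx card_Fp // mul1n.
have cardP := card_residues P_canonical P_symmetric (@subset_refl _ P).
have facetP F : facet P F -> F `<=` P.
  by case=> [[u [b [_ ->]]] _] x [].
have cardF F : facet P F -> F `&` lattice #= `I_#|residues F|.
  by move=> /facetP; exact: card_residues.
have leP : (#|residues P| <= 3 ^ d)%N by rewrite -cardT max_card.
split=> [|F fF|rP].
- by rewrite (card_le_eql cardP) card_le_II.
- by rewrite (card_le_eql (cardF F fF)) card_le_II; exact: card_residues_facet fF.
tfae.
- rewrite (card_eql cardP) => /card_eq_II PT F fF.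
  rewrite (card_eql (cardF F fF)); apply/card_eq_II.
  apply: (card_residues_facet_full P_canonical P_symmetric rP _ fF).
  by apply/eqP; rewrite eqEcard finset.subsetT cardsT cardT PT leqnn.
- move=> FT.
  have [z z0|U uU UP] := @independent_full_normals _ _ _ P_canonical P_symmetric.
    have [u nu zu] := facet_normal_neg P_canonical P_symmetric z0.
    have [w uw] := facet_normal_lattice P_canonical rP nu; rewrite {}uw in nu zu.
    exists w; last by rewrite lt_eqF.
    apply: facet_full_normal => //; apply/card_eq_II.
    by rewrite -(card_eql (cardF _ nu.2)); exact: (FT _ nu.2).
  exact: (full_normals_cube P_canonical P_symmetric uU UP).
move=> /(isomorphic_cube_residues P_canonical P_symmetric) PT.
rewrite (card_eql cardP); apply/card_eq_II/eqP.
by rewrite eqn_leq leP PT.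
Qed.
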